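(* Let $I\subseteq S$ be a monomial ideal. If $I$ has linear quotients, then $I^*$ also has linear quotients.
   Context: Let $K$ be a field and $S=K[x_1,\ldots,x_n]$. Fix an $n$-tuple $(i_1,\ldots,i_n)$ of positive integers, let $S^*$ be the polynomial ring over $K$ in the variables $x_{jk}$, $1\le j\le n$, $1\le k\le i_j$, and set $P_j=(x_{j1},\ldots,x_{ji_j})\subseteq S^*$. For a monomial ideal $I\subseteq S$ generated by monomials $\mathbf{x}^{\mathbf{a}_1},\ldots,\mathbf{x}^{\mathbf{a}_m}$, with $\mathbf{a}_i=(a_i(1),\ldots,a_i(n))$, the expansion of $I$ is the monomial ideal $$I^*=\sum_{i=1}^m P_1^{a_i(1)}\cdots P_n^{a_i(n)}\subseteq S^*,$$ which does not depend on the choice of monomial generators. A monomial ideal $L$ with minimal set of monomial generators $G(L)$ has linear quotients if the elements of $G(L)$ can be ordered $u_1,\ldots,u_m$ so that for each $j=2,\ldots,m$ the colon ideal $(u_1,\ldots,u_{j-1}):u_j$ is generated by a subset of the variables. *)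

(* Defs.v *)
From mathcomp Require Import all_boot all_order all_algebra.
From mathcomp Require Export mpoly.

Set Implicit Arguments.
Unset Strict Implicit.
Unset Printing Implicit Defensive.

Import GRing.Theory.
Local Open Scope ring_scope.

(* Ideals are [Prop]-valued predicates: [ring_quotient]'s [idealr] only covers
   proper, decidable ideals, whereas (1) and undecided colon ideals occur here.
   Equality of ideals is extensional. *)

Definition ideal_sub (R : Type) (I J : R -> Prop) := forall f, I f -> J f.

Definition ideal_eq (R : Type) (I J : R -> Prop) := forall f, I f <-> J f.

Section Ideals.
Variable R : comNzRingType.
Implicit Types (G I J : R -> Prop) (f g h : R).

Definition ideal_gen G : R -> Prop := fun f =>
  exists2 s : seq (R * R),
    (forall p, p \in s -> G p.2) & f = \sum_(p <- s) p.1 * p.2.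

Definition ideal_zero : R -> Prop := fun f => f = 0.

Definition ideal_one : R -> Prop := fun _ => True.

Definition ideal_add I J : R -> Prop := fun f =>
  exists g h, [/\ I g, J h & f = g + h].

Definition ideal_mul I J : R -> Prop :=
  ideal_gen (fun f => exists g h, [/\ I g, J h & f = g * h]).

Definition ideal_exp I (k : nat) : R -> Prop := iter k (ideal_mul I) ideal_one.

Definition ideal_colon I f : R -> Prop := fun g => I (g * f).

End Ideals.

Section MonomialIdeals.
Variables (K : fieldType) (n : nat).
Implicit Types (s t u : seq 'X_{1..n}) (I L : {mpoly K[n]} -> Prop).

Definition monomials_ideal s : {mpoly K[n]} -> Prop :=
  ideal_gen (fun f => exists2 a, a \in s & f = 'X_[a]).

Definition variables_ideal (V : {set 'I_n}) : {mpoly K[n]} -> Prop :=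
  ideal_gen (fun f => exists2 v, v \in V & f = 'X_v).

Definition monomial_ideal I := exists s, ideal_eq I (monomials_ideal s).

(* [u] is an enumeration, in some order and without repetition, of the minimal
   set G(L) of monomial generators of [L]. *)
Definition minimal_generators u L :=
  [/\ uniq u, ideal_eq L (monomials_ideal u)
    & forall t, {subset t <= u} -> ideal_eq L (monomials_ideal t) ->
        {subset u <= t}].

(* Positions are counted from 0, so that [take j u] are the generators before
   [nth 0%MM u j]. *)
Definition linear_quotients L := exists2 u, minimal_generators u L &
  forall j : nat, (0 < j < size u)%N -> exists V : {set 'I_n},
    ideal_eq (ideal_colon (monomials_ideal (take j u)) 'X_[nth 0%MM u j])
             (variables_ideal V).

End MonomialIdeals.

Arguments monomials_ideal K {n} s _.

Section Expansion.
Variables (K : fieldType) (n : nat) (d : 'I_n -> nat).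

(* The variable x_{jk} of S^* is ['X_(tagnat.Rank j k)], where [tagnat.Rank] is
   the bijection from the pairs (j, k), k : 'I_(d j), onto 'I_(\sum_j d j). *)
Definition expansion_ring := {mpoly K[(\sum_(j < n) d j)%N]}.

Definition block_ideal (j : 'I_n) : expansion_ring -> Prop :=
  ideal_gen (fun f => exists k : 'I_(d j), f = 'X_(tagnat.Rank j k)).

Definition expansion_monomial (a : 'X_{1..n}) : expansion_ring -> Prop :=
  \big[@ideal_mul _ / @ideal_one _]_(j < n) ideal_exp (block_ideal j) (a j).

Definition expansion_generators (s : seq 'X_{1..n}) : expansion_ring -> Prop :=
  \big[@ideal_add _ / @ideal_zero _]_(a <- s) expansion_monomial a.

(* [expansion I] is [expansion_generators s] for any finite family [s] of
   monomial generators of [I], see [expansionE] below. *)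
Definition expansion (I : {mpoly K[n]} -> Prop) : expansion_ring -> Prop :=
  fun f => exists2 s, ideal_eq I (monomials_ideal K s)
                    & expansion_generators s f.

End Expansion.

Arguments expansion_monomial K {n} d a _.
Arguments expansion_generators K {n} d s _.
Arguments expansion {K n} d I _.

Section ExpansionWellDefined.

Lemma mem_ideal_gen (R : comNzRingType) (G : R -> Prop) f :
  G f -> ideal_gen G f.
Proof.
move=> Gf; exists [:: (1, f)]; last by rewrite big_seq1 mul1r.
by move=> p; rewrite inE => /eqP ->.
Qed.

Definition is_ideal (R : comNzRingType) (I : R -> Prop) :=
  [/\ I 0, forall f g, I f -> I g -> I (f + g) & forall f g, I g -> I (f * g)].

Lemma ideal_gen_is_ideal (R : comNzRingType) (G : R -> Prop) :
  is_ideal (ideal_gen G).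
Proof.
split=> [|f g [s sG ->] [t tG ->]|f g [s sG ->]].
- by exists [::]; rewrite ?big_nil.
- exists (s ++ t); last by rewrite big_cat.
  by move=> p; rewrite mem_cat => /orP[/sG|/tG].
- exists [seq (f * p.1, p.2) | p <- s]; first by move=> _ /mapP[p /sG ? ->].
  by rewrite big_map mulr_sumr; apply: eq_bigr => p _; rewrite mulrA.
Qed.

Lemma ideal_gen_min (R : comNzRingType) (G I : R -> Prop) :
  is_ideal I -> ideal_sub G I -> ideal_sub (ideal_gen G) I.
Proof.
move=> [I0 ID IM] GI _ [s sG ->]; rewrite big_seq.
by apply: big_ind => // p /sG /GI /IM.
Qed.

Lemma ideal_mul_sub (R : comNzRingType) (I J I' J' : R -> Prop) :
  ideal_sub I I' -> ideal_sub J J' ->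
  ideal_sub (ideal_mul I J) (ideal_mul I' J').
Proof.
move=> sI sJ; apply: ideal_gen_min (ideal_gen_is_ideal _) _ => _ [g [h [Ig Jh ->]]].
by apply: mem_ideal_gen; exists g, h; split; [apply: sI | apply: sJ |].
Qed.

Lemma ideal_exp_is_ideal (R : comNzRingType) (I : R -> Prop) k :
  is_ideal (ideal_exp I k).
Proof. by case: k => [|k]; [split | apply: ideal_gen_is_ideal]. Qed.

Lemma ideal_exp_sub (R : comNzRingType) (I : R -> Prop) k l :
  (k <= l)%N -> ideal_sub (ideal_exp I l) (ideal_exp I k).
Proof.
move=> /subnK <-; elim: (l - k)%N => [//|m IHm] f Hf; apply: IHm.
move: f Hf; apply: ideal_gen_min (ideal_exp_is_ideal _ _) _ => _ [g [h [_ Hh ->]]].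
by case: (ideal_exp_is_ideal I (m + k)) => _ _; apply.
Qed.

Variables (K : fieldType) (n : nat) (d : 'I_n -> nat).

Lemma monomials_ideal_divides (s : seq 'X_{1..n}) a :
  monomials_ideal K s 'X_[a] -> exists2 b, b \in s & (b <= a)%MM.
Proof.
move=> [t tG Xa]; have : (\sum_(p <- t) p.1 * p.2)@_a != 0.
  by rewrite -Xa mcoeffX eqxx oner_neq0.
rewrite raddf_sum; case: (boolP (has (fun p => (p.1 * p.2)@_a != 0) t)).
  case/hasP=> p /tG [b bs ->] nz _; exists b => //.
  rewrite -mcoeff_msupp (perm_mem (msuppMX _ _)) in nz.
  by case/mapP: nz => m _ ->; apply: lem_addr.
move=> /hasPn t0; rewrite big_seq big1 ?eqxx // => p /t0.
by rewrite negbK => /eqP.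
Qed.

Lemma expansion_monomial_sub a b : (b <= a)%MM ->
  ideal_sub (expansion_monomial K d a) (expansion_monomial K d b).
Proof.
move=> /mnm_lepP le_ba; apply: (big_ind2 (@ideal_sub _)) => //.
- by move=> *; apply: ideal_mul_sub.
- by move=> j _; apply: ideal_exp_sub.
Qed.

Lemma expansion_monomial_is_ideal a : is_ideal (expansion_monomial K d a).
Proof.
by apply: big_ind => [|*|*]; [split | apply: ideal_gen_is_ideal
  | apply: ideal_exp_is_ideal].
Qed.

Lemma ideal_add_is_ideal (R : comNzRingType) (I J : R -> Prop) :
  is_ideal I -> is_ideal J -> is_ideal (ideal_add I J).
Proof.
move=> [I0 ID IM] [J0 JD JM]; split.
- by exists 0, 0; rewrite addr0.
- move=> _ _ [g [h [Ig Jh ->]]] [g' [h' [Ig' Jh' ->]]].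
  by exists (g + g'), (h + h'); rewrite addrACA; split; [apply: ID | apply: JD |].
- move=> f _ [g [h [Ig Jh ->]]].
  by exists (f * g), (f * h); rewrite mulrDr; split; [apply: IM | apply: JM |].
Qed.

Lemma expansion_generators_is_ideal s : is_ideal (expansion_generators K d s).
Proof.
apply: big_ind => [|*|*]; last exact: expansion_monomial_is_ideal.
- by split=> [|f g -> ->|f g ->]; rewrite /ideal_zero ?addr0 ?mulr0.
- exact: ideal_add_is_ideal.
Qed.

Lemma expansion_monomial_generators s a : a \in s ->
  ideal_sub (expansion_monomial K d a) (expansion_generators K d s).
Proof.
elim: s => // b s IHs; rewrite inE /expansion_generators big_cons => + f af.
case/predU1P=> [<-|/IHs /(_ f af) sf]; [exists f, 0 | exists 0, f].
- by rewrite addr0; split=> //; case: (expansion_generators_is_ideal s).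
- by rewrite add0r; split=> //; case: (expansion_monomial_is_ideal b).
Qed.

Lemma expansion_generators_sub (s t : seq 'X_{1..n}) :
  ideal_sub (monomials_ideal K s) (monomials_ideal K t) ->
  ideal_sub (expansion_generators K d s) (expansion_generators K d t).
Proof.
move=> st; rewrite {1}/expansion_generators big_seq.
have [t0 tD _] := expansion_generators_is_ideal t.
apply: (big_ind (fun J => ideal_sub J (expansion_generators K d t))) =>
  [f -> //|I J sI sJ _ [g [h [Ig Jh ->]]]|a sa f af].
  by apply: tD; [apply: sI | apply: sJ].
have /st /monomials_ideal_divides [b tb le_ba] : monomials_ideal K s 'X_[a].
  by apply: mem_ideal_gen; exists a.
exact/(expansion_monomial_generators tb)/(expansion_monomial_sub le_ba).
Qed.

Lemma expansionE (I : {mpoly K[n]} -> Prop) (s : seq 'X_{1..n}) :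
  ideal_eq I (monomials_ideal K s) ->
  ideal_eq (expansion d I) (expansion_generators K d s).
Proof.
move=> Is f; split=> [[t It]|]; last by exists s.
by apply: expansion_generators_sub => g /It /Is.
Qed.

End ExpansionWellDefined.

(* Main.v *)
Require Import Defs.
From mathcomp Require Import all_boot all_order all_algebra.

Set Implicit Arguments.
Unset Strict Implicit.
Unset Printing Implicit Defensive.

Import Order.TTheory GRing.Theory.
Local Open Scope ring_scope.

(** Send a monomial of S^* to its vector of block degrees. The minimal generators
    of I^* are the monomials over those of I; order them by the position of
    their image among the generators of I and, over a common image, with the
    lexicographically larger ones first. Let a come before b. If their images
    differ, then linear quotients of I give a variable x_v and an earlier
    generator c dividing x_v times the image of b: pick r in block v with
    a_r > b_r, and lift c to a divisor of b x_r. If the images agree, let r be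
    the first index at which a and b differ, so that a_r > b_r, and take s > r
    in the same block with a_s < b_s: then b x_r / x_s comes before b. *)

(** Position in a strictly sorted sequence follows the key, so the earlier generators can be
    recognised by comparing keys. *)
Lemma mem_take_sorted (T : eqType) (disp : Order.disp_t) (O : orderType disp)
    (key : T -> O) (x0 : T) (w : seq T) (j : nat) (b : T) :
  sorted (fun x y => key x < key y)%O w -> (j < size w)%N ->
  (b \in take j w) = (b \in w) && (key b < key (nth x0 w j))%O.
Proof.
move=> w_sorted lt_j.
have key_tr : transitive (fun x y => key x < key y)%O.
  by move=> y x z; apply: lt_trans.
have w_uniq : uniq w.
  by apply: (sorted_uniq key_tr) w_sorted => x; rewrite ltxx.
have [bw|bNw] := boolP (b \in w); last first.
  by apply: contraNF bNw => /mem_take.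
have jw := mem_nth x0 lt_j; have jE := index_uniq x0 lt_j w_uniq.
rewrite in_take //= -{1}jE; apply/idP/idP => [lt_bj|lt_key].
  exact: (sorted_ltn_index key_tr w_sorted).
case: ltngtP => // [gt_bj|eq_bj].
  have /= := sorted_ltn_index key_tr w_sorted _ _ jw bw gt_bj.
  by move/(lt_trans lt_key); rewrite ltxx.
have bE : b = nth x0 w j by rewrite -(nth_index x0 bw) eq_bj jE.
by rewrite bE ltxx in lt_key.
Qed.

(** * Monomial ideals as sets of exponents *)

Section SupportedIdeals.
Variables (K : fieldType) (n : nat).
Implicit Types (m a b c : 'X_{1..n}) (U W : 'X_{1..n} -> Prop).
Implicit Types (I J : {mpoly K[n]} -> Prop) (f g : {mpoly K[n]}).

(** Encodes a monomial ideal by its exponents when [U] is upward closed; equalities of ideals then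
    become equivalences of predicates on exponents. *)
Definition supported U f := forall m, m \in msupp f -> U m.

Lemma supported_is_ideal U :
  (forall m m', U m' -> U (m + m')%MM) -> is_ideal (supported U).
Proof.
move=> U_add; split=> [m|f g Uf Ug m|f g Ug m].
- by rewrite msupp0.
- by move/msuppD_le; rewrite mem_cat => /orP[/Uf|/Ug].
- by move/msuppM_le => /allpairsP[[m1 m2] [_ /= /Ug Um2 ->]]; apply: U_add.
Qed.

Lemma supportedX U m : supported U 'X_[m] <-> U m.
Proof.
split=> [|Um m']; first by apply; rewrite msuppX inE.
by rewrite msuppX inE => /eqP ->.
Qed.

Lemma supported_sub U I :
  is_ideal I -> (forall m, U m -> I 'X_[m]) -> ideal_sub (supported U) I.
Proof.
move=> [I0 ID IM] UI f Uf; rewrite [f]mpolyE big_seq.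
by apply: big_ind => // m /Uf /UI; rewrite -mul_mpolyC; apply: IM.
Qed.

Lemma supported_ext U W : (forall m, U m <-> W m) ->
  ideal_eq (supported U) (supported W).
Proof. by move=> UW f; split=> Uf m /Uf /UW. Qed.

(** The exponents of a product lie in the sumset, and a further monomial factor is absorbed by the
    summand from [U]. *)
Lemma ideal_mulE U W I J :
  (forall m m', U m' -> U (m + m')%MM) ->
  ideal_eq I (supported U) -> ideal_eq J (supported W) ->
  ideal_eq (ideal_mul I J)
    (supported (fun m => exists m1 m2, [/\ U m1, W m2 & m = (m1 + m2)%MM])).
Proof.
move=> U_add IU JW f; split.
  move: f; apply: ideal_gen_min.
    apply: supported_is_ideal => m _ [m1 [m2 [Um1 Wm2 ->]]].
    by exists (m + m1)%MM, m2; rewrite addmA; split=> //; apply: U_add.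
  move=> _ [g [h [/IU Ug /JW Wh ->]]] m.
  by case/msuppM_le/allpairsP=> -[m1 m2] [/= /Ug ? /Wh ? ->]; exists m1, m2.
move: f; apply: supported_sub; first exact: ideal_gen_is_ideal.
move=> _ [m1 [m2 [Um1 Wm2 ->]]]; apply: mem_ideal_gen.
by exists 'X_[m1], 'X_[m2]; rewrite mpolyXD; split=> //;
  [apply/IU/supportedX | apply/JW/supportedX].
Qed.

Lemma monomials_idealE (s : seq 'X_{1..n}) :
  ideal_eq (monomials_ideal K s)
           (supported (fun m => exists2 b, b \in s & (b <= m)%MM)).
Proof.
move=> f; split; move: f.
  apply: ideal_gen_min.
    apply: supported_is_ideal => m m' [b bs le_b]; exists b => //.
    exact: lepm_trans (lem_addl m m').
  by move=> _ [b bs ->]; apply/supportedX; exists b => //; apply: lepm_refl.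
apply: supported_sub; first exact: ideal_gen_is_ideal.
move=> m [b bs /submK <-]; rewrite mpolyXD.
have [_ _ IM] := ideal_gen_is_ideal (fun f : {mpoly K[n]} =>
  exists2 a, a \in s & f = 'X_[a]).
by apply: IM; apply: mem_ideal_gen; exists b.
Qed.

Lemma variables_idealE (V : {set 'I_n}) :
  ideal_eq (variables_ideal (K := K) V)
           (supported (fun m => exists2 v, v \in V & m v != 0%N)).
Proof.
move=> f; split; move: f.
  apply: ideal_gen_min.
    apply: supported_is_ideal => m m' [v vV nz]; exists v => //.
    by rewrite mnmDE addn_eq0 negb_and nz orbT.
  by move=> _ [v vV ->]; apply/supportedX; exists v; rewrite // mnm1E eqxx.
apply: supported_sub; first exact: ideal_gen_is_ideal.
move=> m [v vV]; rewrite -lep1mP => /submK <-; rewrite mpolyXD.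
have [_ _ IM] := ideal_gen_is_ideal (fun f : {mpoly K[n]} =>
  exists2 v, v \in V & f = 'X_v).
by apply: IM; apply: mem_ideal_gen; exists v.
Qed.

Lemma ideal_colonE (s : seq 'X_{1..n}) a :
  ideal_eq (ideal_colon (monomials_ideal K s) 'X_[a])
           (supported (fun m => exists2 b, b \in s & (b <= a + m)%MM)).
Proof.
move=> f; split=> [/monomials_idealE sf m mf|sf].
  by apply: sf; rewrite (perm_mem (msuppMX _ _)) map_f.
apply/monomials_idealE => m; rewrite (perm_mem (msuppMX _ _)).
by case/mapP=> m' /sf ? ->.
Qed.

Definition antichain (u : seq 'X_{1..n}) :=
  {in u &, forall a b, (a <= b)%MM -> a = b}.

Lemma minimal_generatorsE (u : seq 'X_{1..n}) I :
  minimal_generators u I <->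
    [/\ uniq u, ideal_eq I (monomials_ideal K u) & antichain u].
Proof.
split=> [[u_uniq Iu u_min]|[u_uniq Iu u_anti]]; split=> //.
- move=> a b au bu le_ab; apply/eqP/negPn/negP => ne_ab.
  have /u_min : {subset rem b u <= u} by move=> c /mem_rem.
  suff Ib : ideal_eq I (monomials_ideal K (rem b u)).
    by move=> /(_ Ib b bu); rewrite mem_rem_uniq // inE eqxx.
  have a_rem : a \in rem b u by rewrite mem_rem_uniq // inE ne_ab.
  move=> f; split=> [/Iu/monomials_idealE uf|/monomials_idealE uf].
    apply/monomials_idealE => m /uf[c cu le_c].
    have [eq_cb|ne_cb] := eqVneq c b.
      by exists a => //; apply: lepm_trans le_ab _; rewrite -eq_cb.
    by exists c => //; rewrite mem_rem_uniq // inE ne_cb.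
  by apply/Iu/monomials_idealE => m /uf[c /mem_rem]; exists c.
- move=> t tu It a au.
  have /Iu/It/monomials_ideal_divides[b bt le_ba] : monomials_ideal K u 'X_[a].
    by apply: mem_ideal_gen; exists a.
  by rewrite -(u_anti b a (tu _ bt) au le_ba).
Qed.

(* The combinatorial form of linear quotients: every [a] before [b] is separated
   from [b] by a variable [x_v] of the colon ideal. *)
Definition linear_steps (u : seq 'X_{1..n}) :=
  forall j, (j < size u)%N -> forall a, a \in take j u ->
    let b := nth 0%MM u j in
    exists v c, [/\ (b v < a v)%N, c \in take j u & (c <= b + U_(v))%MM].

Lemma linear_quotientsE I :
  linear_quotients I <->
  exists u, [/\ uniq u, ideal_eq I (monomials_ideal K u), antichain u
              & linear_steps u].
Proof.
split=> [[u /minimal_generatorsE[u_uniq Iu u_anti] u_lin]|].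
  exists u; split=> // j lt_j a a_take b.
  (* At position 0 the prefix is empty, so [linear_steps] is vacuous there. *)
  have j_gt0 : (0 < j)%N by case: j a_take {lt_j b}; rewrite ?take0.
  have [|V colonV] := u_lin j; first by rewrite j_gt0.
  (* Subtraction is truncated, so [b + (a - b)] is the exponent of the lcm and the monomial of
     exponent [a - b] lies in the colon ideal; a variable occurring in it is one where [a] exceeds
     [b]. *)
  have /colonV/variables_idealE/supportedX[v vV] :
      ideal_colon (monomials_ideal K (take j u)) 'X_[b] 'X_[(a - b)%MM].
    apply/ideal_colonE/supportedX; exists a => //.
    by apply/mnm_lepP => i; rewrite mnmDE mnmBE -maxnE leq_maxr.
  rewrite mnmBE subn_eq0 -ltnNge => lt_v.
  have /colonV/ideal_colonE/supportedX[c c_take le_c] :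
      variables_ideal (K := K) V 'X_v.
    by apply: mem_ideal_gen; exists v.
  by exists v, c.
move=> [u [u_uniq Iu u_anti u_lin]]; exists u; first exact/minimal_generatorsE.
move=> j /andP[_ lt_j]; set b := nth _ _ _.
(* The witness collects the variables lying in the colon ideal; [u_lin] shows that every exponent of
   the colon ideal involves one of them. *)
exists [set v | has (fun c => (c <= b + U_(v))%MM) (take j u)] => f.
split=> [/ideal_colonE uf|/variables_idealE uf].
  apply/variables_idealE => m /uf[a a_take /mnm_lepP le_a].
  have [v [c [lt_v c_take le_c]]] := u_lin j lt_j a a_take.
  exists v; first by rewrite inE; apply/hasP; exists c.
  by have := leq_trans lt_v (le_a v); rewrite mnmDE -addn1 leq_add2l lt0n.
apply/ideal_colonE => m /uf[v]; rewrite inE => /hasP[c c_take le_c] nz_v.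
exists c => //; apply: lepm_trans le_c _; apply/mnm_lepP => i.
rewrite !mnmDE leq_add2l mnm1E.
by case: eqP => // <-; rewrite lt0n.
Qed.

End SupportedIdeals.

(** * The grading of S^* by blocks of variables *)

Section BlockDegree.
Variables (n : nat) (d : 'I_n -> nat).
Local Notation N := (\sum_(j < n) d j)%N.
Implicit Types (m b e : 'X_{1..N}) (r s : 'I_N).

(** Exponent of the image of a monomial under the substitution sending every x_{jk} to x_j. *)
Definition block_degree m : 'X_{1..n} :=
  [multinom (\sum_(r | tagnat.sig1 r == j) m r)%N | j < n].

Lemma block_degreeD m m' :
  block_degree (m + m')%MM = (block_degree m + block_degree m')%MM.
Proof.
apply/mnmP => j; rewrite mnmDE !mnmE -big_split.
by apply: eq_bigr => r _; rewrite mnmDE.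
Qed.

Lemma block_degree1 r : block_degree U_(r)%MM = U_(tagnat.sig1 r)%MM.
Proof.
apply/mnmP => j; rewrite mnm1E mnmE; case: eqP => [<-|ne_j].
  rewrite (bigD1 r) //= mnm1E eqxx big1 // => s /andP[_ ne_s].
  by rewrite mnm1E eq_sym (negPf ne_s).
rewrite big1 // => s /eqP sj; rewrite mnm1E; case: eqP => // rs.
by case: ne_j; rewrite rs.
Qed.

Lemma mdeg_block_degree m : mdeg (block_degree m) = mdeg m.
Proof.
rewrite !mdegE (partition_big (@tagnat.sig1 _ d) predT) //=.
by apply: eq_bigr => j _; rewrite mnmE.
Qed.

Lemma block_degree_mono m m' :
  (m <= m')%MM -> (block_degree m <= block_degree m')%MM.
Proof. by move=> /submK <-; rewrite block_degreeD lem_addl. Qed.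

(** Block degree preserves total degree, so the cofactor of [m] in [m'] has degree 0. *)
Lemma block_degree_inj m m' :
  (m <= m')%MM -> block_degree m = block_degree m' -> m = m'.
Proof.
move=> /submK <- /(congr1 (@mdeg n)); rewrite !mdeg_block_degree mdegD.
move=> /(canLR (addnK _)); rewrite subnn => /esym/eqP.
by rewrite mdeg_eq0 => /eqP ->; rewrite add0m.
Qed.

Lemma block_degree_lt m m' j : (block_degree m j < block_degree m' j)%N ->
  exists2 r, tagnat.sig1 r = j & (m r < m' r)%N.
Proof.
rewrite !mnmE => lt_sum.
have [/exists_inP[r /eqP rj lt_r]|] :=
  boolP [exists (r | tagnat.sig1 r == j), (m r < m' r)%N]; first by exists r.
rewrite negb_exists_in => /forall_inP le_m.
move: lt_sum; rewrite ltnNge => /negP[].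
by apply: leq_sum => r /le_m; rewrite -leqNgt.
Qed.

Lemma block_degree_gt0 m j : (0 < block_degree m j)%N ->
  exists2 r, tagnat.sig1 r = j & (U_(r) <= m)%MM.
Proof.
move=> m_gt0; have [|r rj] := @block_degree_lt 0%MM m j.
  by apply: leq_ltn_trans m_gt0; rewrite mnmE big1 // => r _; rewrite mnm0E.
by rewrite mnm0E lt0n -lep1mP; exists r.
Qed.

(** Induction on the total degree of [m]: as long as some block has excess degree, one variable of
    that block is removed. This lifts divisors from S to S^*. *)
Lemma block_degree_truncate (a : 'X_{1..n}) m :
  (a <= block_degree m)%MM -> exists2 b, (b <= m)%MM & block_degree b = a.
Proof.
move: {2}(mdeg m) (erefl (mdeg m)) => k; elim: k m => [|k IHk] m mk le_a.
  exists m; first exact: lepm_refl.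
  move: mk => /eqP; rewrite -mdeg_block_degree mdeg_eq0 => /eqP m0.
  move: le_a; rewrite m0 => /mnm_lepP le_a; apply/mnmP => j.
  by apply/esym/eqP; move: (le_a j); rewrite mnm0E leqn0.
have [->|ne_a] := eqVneq a (block_degree m).
  by exists m; rewrite ?lepm_refl.
have [j lt_j] : exists j, (a j < block_degree m j)%N.
  apply/existsP; apply: contraR ne_a; rewrite negb_exists => /forallP ge_a.
  apply/eqP/mnmP => j; apply/eqP; rewrite eqn_leq (mnm_lepP le_a) /=.
  by rewrite leqNgt ge_a.
have [r rj /submK mE] := block_degree_gt0 (leq_ltn_trans (leq0n _) lt_j).
have [|| b le_b bE] := IHk (m - U_(r))%MM.
- by apply/eqP; rewrite -eqSS -mk -{2}mE mdegD mdeg1 addn1.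
- apply/mnm_lepP => i; move: lt_j (mnm_lepP le_a i).
  rewrite -{1 2}mE block_degreeD block_degree1 rj !mnmDE !mnm1E eqxx.
  by case: eqP => [<-|_] /=; rewrite ?addn0 // addn1 ltnS.
by exists b => //; apply: lepm_trans le_b (lem_subr _ _).
Qed.

(** The exponent form of P_j^{k+1} = P_j P_j^k: one variable of block [j] is split off. *)
Lemma block_degree_split m j k : (k < block_degree m j)%N <->
  exists m1 m2, [/\ (0 < block_degree m1 j)%N, (k <= block_degree m2 j)%N
                  & m = (m1 + m2)%MM].
Proof.
split=> [lt_k|[m1 [m2 [m1_gt0 le_k ->]]]]; last first.
  by rewrite block_degreeD mnmDE -add1n leq_add.
have [r rj /submK mE] := block_degree_gt0 (leq_ltn_trans (leq0n _) lt_k).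
exists U_(r)%MM, (m - U_(r))%MM; rewrite addmC mE; split=> //.
  by rewrite block_degree1 rj mnm1E eqxx.
move: lt_k; rewrite -{1}mE block_degreeD block_degree1 rj mnmDE mnm1E eqxx.
by rewrite addn1.
Qed.

(** Separates a monomial along the disjoint blocks, in order to factor it in a product of powers of
    the P_j. *)
Definition block_part (P : pred 'I_n) m : 'X_{1..N} :=
  [multinom (if P (tagnat.sig1 r) then m r else 0)%N | r < N].

Lemma block_part_degree P m j :
  block_degree (block_part P m) j = (if P j then block_degree m j else 0)%N.
Proof.
rewrite !mnmE; case: ifP => Pj.
  by apply: eq_bigr => r /eqP rj; rewrite mnmE rj Pj.
by rewrite big1 // => r /eqP rj; rewrite mnmE rj Pj.
Qed.

Lemma block_partC P m : (block_part P m + block_part (predC P) m)%MM = m.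
Proof.
apply/mnmP => r; rewrite mnmDE !mnmE /=.
by case: (P _); rewrite ?addn0.
Qed.

End BlockDegree.

(** * Exponents of the expanded ideal *)

Section ExpansionSupport.
Variables (K : fieldType) (n : nat) (d : 'I_n -> nat).
Local Notation N := (\sum_(j < n) d j)%N.
Implicit Types (m b : 'X_{1..N}) (a : 'X_{1..n}).

Lemma block_idealE j :
  ideal_eq (@block_ideal K n d j)
           (supported (fun m => (0 < block_degree m j)%N)).
Proof.
move=> f; split; move: f.
  apply: ideal_gen_min.
    apply: supported_is_ideal => m m' m'_gt0.
    by rewrite block_degreeD mnmDE ltn_addl.
  move=> _ [k ->]; apply/supportedX.
  by rewrite block_degree1 tagnat.Rank1K mnm1E eqxx.
apply: supported_sub; first exact: ideal_gen_is_ideal.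
move=> m /block_degree_gt0[r rj /submK <-]; rewrite mpolyXD.
have [_ _ IM] := ideal_gen_is_ideal (fun f : {mpoly K[N]} =>
  exists k : 'I_(d j), f = 'X_(tagnat.Rank j k)).
apply: IM; apply: mem_ideal_gen; rewrite -rj.
by exists (tagnat.sig2 r); rewrite tagnat.sig2K.
Qed.

Lemma block_ideal_expE j k :
  ideal_eq (ideal_exp (@block_ideal K n d j) k)
           (supported (fun m => (k <= block_degree m j)%N)).
Proof.
elim: k => [|k IHk] f; first by split.
have Uadd m m' :
    (0 < block_degree m' j)%N -> (0 < block_degree (m + m')%MM j)%N.
  by move=> m'_gt0; rewrite block_degreeD mnmDE ltn_addl.
have -> : ideal_exp (@block_ideal K n d j) k.+1 f <->
  ideal_mul (@block_ideal K n d j) (ideal_exp (@block_ideal K n d j) k) f by [].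
rewrite (ideal_mulE Uadd (block_idealE j) IHk f).
by apply: supported_ext => m; apply: iff_sym; apply: block_degree_split.
Qed.

Lemma expansion_monomialE a :
  ideal_eq (expansion_monomial K d a)
           (supported (fun m => (a <= block_degree m)%MM)).
Proof.
(* The product is computed over any duplicate-free list of blocks, which allows induction on the
   list. *)
suff E (r : seq 'I_n) : uniq r -> ideal_eq
    (\big[@ideal_mul _ / @ideal_one _]_(j <- r)
        ideal_exp (@block_ideal K n d j) (a j))
    (supported (fun m => forall j, j \in r -> (a j <= block_degree m j)%N)).
  move=> f; rewrite /expansion_monomial (E _ (index_enum_uniq _) f).
  apply: supported_ext => m; split=> [le_a|/mnm_lepP le_a j _]; last exact: le_a.
  by apply/mnm_lepP => j; apply/le_a/mem_index_enum.
elim: r => [_|i r IHr /= /andP[iNr r_uniq]] f.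
  by rewrite big_nil; split.
have Uadd m m' :
    (a i <= block_degree m' i)%N -> (a i <= block_degree (m + m')%MM i)%N.
  by move=> le_a; rewrite block_degreeD mnmDE (leq_trans le_a) ?leq_addl.
rewrite big_cons (ideal_mulE Uadd (block_ideal_expE i (a i)) (IHr r_uniq) f).
apply: supported_ext => m; split=> [[m1 [m2 [le_i le_r ->]]] j|le_a].
  rewrite inE block_degreeD mnmDE => /predU1P[->|/le_r le_j].
    exact: leq_trans le_i (leq_addr _ _).
  exact: leq_trans le_j (leq_addl _ _).
(* Since [i] is not in [r], the factor outside block [i] keeps every block of [r] intact. *)
exists (block_part (pred1 i) m), (block_part (predC1 i) m).
split; last by rewrite block_partC.
  by rewrite block_part_degree /= eqxx le_a ?mem_head.
move=> j jr; rewrite block_part_degree /= ifT ?le_a ?inE ?jr ?orbT //.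
by apply: contraNneq iNr => <-.
Qed.

Lemma expansion_generatorsE (s : seq 'X_{1..n}) :
  ideal_eq (expansion_generators K d s)
    (supported (fun m => exists2 a, a \in s & (a <= block_degree m)%MM)).
Proof.
move=> f; split; move: f; last first.
  apply: supported_sub; first exact: expansion_generators_is_ideal.
  move=> m [a sa le_a]; apply: (expansion_monomial_generators sa).
  exact/expansion_monomialE/supportedX.
rewrite /expansion_generators; elim: s => [|a s IHs] f.
  by rewrite big_nil => -> m; rewrite msupp0.
rewrite big_cons => -[g [h [/expansion_monomialE ag /IHs sh ->]]] m.
move/msuppD_le; rewrite mem_cat => /orP[/ag|/sh[b sb]].
  by exists a; rewrite ?mem_head.
by exists b; rewrite // inE sb orbT.
Qed.

(** By truncation, each exponent of the expansion lies above one whose block degree is exactly a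
    member of [s]. *)
Lemma expansion_generators_lift (s : seq 'X_{1..n}) (w : seq 'X_{1..N}) :
  (forall b, (b \in w) = (block_degree b \in s)) ->
  ideal_eq (expansion_generators K d s) (monomials_ideal K w).
Proof.
move=> wE f; rewrite expansion_generatorsE (monomials_idealE w f).
apply: supported_ext => m; split=> [[a sa]|[b bw le_b]].
  by case/block_degree_truncate => b le_b bE; exists b; rewrite // wE bE.
by exists (block_degree b); rewrite -?wE ?block_degree_mono.
Qed.

End ExpansionSupport.

(** * Ordering the generators of the expansion *)

Section Lift.
Variables (n : nat) (d : 'I_n -> nat) (u : seq 'X_{1..n}).
Local Notation N := (\sum_(j < n) d j)%N.

(* The order on ['X_{1..N}] is degree-lexicographic, hence lexicographic on the
   fibres of [block_degree], where the degree is constant. *)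
Definition lift_key (b : 'X_{1..N}) : nat *l ('X_{1..N})^d :=
  (index (block_degree b) u, b).

Lemma lift_key_inj : injective lift_key.
Proof. by move=> b b' []. Qed.

Lemma lt_lift_key b b' : (lift_key b < lift_key b')%O =
  (index (block_degree b) u < index (block_degree b') u)%N ||
  (index (block_degree b) u == index (block_degree b') u) && (b' < b)%O.
Proof.
rewrite ltEprodlexi /= !leEnat -ltEdual.
by case: ltngtP.
Qed.

Lemma lift_exists : exists w : seq 'X_{1..N},
  sorted (fun b b' => lift_key b < lift_key b')%O w /\
  forall b, (b \in w) = (block_degree b \in u).
Proof.
(* Block degree preserves total degree, so [D] strictly bounds the degree of every monomial over
   [u], and these can be enumerated. *)
pose D := (\max_(a <- u) mdeg a).+1.
pose e := [seq b <- [seq val b | b : 'X_{1..N < D}] | block_degree b \in u].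
exists (sort (fun b b' => lift_key b <= lift_key b')%O e); split.
  rewrite -sorted_map lt_sorted_uniq_le.
  rewrite map_inj_uniq; last exact: lift_key_inj.
  rewrite sort_uniq filter_uniq //=; last by apply/injectiveP/val_inj.
  by rewrite sorted_map; apply: sort_sorted => b b'; apply: le_total.
move=> b; rewrite mem_sort mem_filter andb_idr // => ub.
have ltD : (mdeg b < D)%N.
  by rewrite ltnS -mdeg_block_degree leq_bigmax_seq.
by apply/imageP; exists (BMultinom ltD).
Qed.

Lemma lift_antichain (w : seq 'X_{1..N}) :
  (forall b, (b \in w) = (block_degree b \in u)) -> antichain u -> antichain w.
Proof.
move=> wE u_anti b b'; rewrite !wE => ub ub' le_b.
by apply: block_degree_inj => //; apply: u_anti => //; apply: block_degree_mono.
Qed.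

Lemma lift_linear_steps (w : seq 'X_{1..N}) :
  sorted (fun b b' => lift_key b < lift_key b')%O w ->
  (forall b, (b \in w) = (block_degree b \in u)) ->
  uniq u -> linear_steps u -> linear_steps w.
Proof.
move=> w_sorted wE u_uniq u_lin j lt_j a a_take; set b := nth _ _ _ => /=.
have ub : block_degree b \in u by rewrite -wE mem_nth.
move: a_take; rewrite (mem_take_sorted 0%MM _ w_sorted) // -/b wE lt_lift_key.
case/andP=> ua /orP[lt_ab|/andP[/eqP eq_ab lt_ba]].
  have [||v [c [lt_v c_take le_c]]] :=
    u_lin (index (block_degree b) u) _ (block_degree a).
  - by rewrite index_mem.
  - by rewrite in_take.
  rewrite nth_index // in lt_v le_c.
  have [r rv lt_r] := block_degree_lt lt_v.
  (* As x_r maps to x_v, [c] divides the image of b x_r; its lift [e] comes before [b] because [c]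
     has the smaller index in [u]. *)
  have [|e le_e eE] := @block_degree_truncate n d c (b + U_(r))%MM.
    by rewrite block_degreeD block_degree1 rv.
  exists r, e; split=> //; rewrite (mem_take_sorted 0%MM _ w_sorted) // wE eE.
  have cu := mem_take c_take.
  by rewrite cu lt_lift_key eE -in_take ?c_take.
have {}eq_ab : block_degree a = block_degree b.
  by rewrite -(nth_index 0%MM ua) eq_ab nth_index.
(* Equal images give equal total degrees, so the comparison is purely lexicographic and [r] is the
   first difference. *)
have /ltmcP[|r agree lt_r] := lt_ba.
  by rewrite -!mdeg_block_degree eq_ab.
(* The two degrees in the block of [r] agree, so the surplus of [a] at [r] is compensated within
   that block. *)
have [s sr lt_s] : exists2 s, tagnat.sig1 s = tagnat.sig1 r & (a s < b s)%N.
  have [/exists_inP[s /eqP sr lt_s]|] := boolP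
    [exists (s | tagnat.sig1 s == tagnat.sig1 r), (a s < b s)%N].
    by exists s.
  rewrite negb_exists_in => /forall_inP le_b.
  have /mnmP/(_ (tagnat.sig1 r))/eqP := eq_ab.
  rewrite !mnmE (bigD1 r) // [X in _ == X](bigD1 r) //= eq_sym ltn_eqF //.
  rewrite -addSn leq_add // leq_sum // => i /andP[/le_b].
  by rewrite -leqNgt.
have lt_rs : (r < s)%N.
  case: (ltngtP r s) => // [/agree eq_s|/val_inj eq_s].
    by rewrite eq_s ltnn in lt_s.
  by move: lt_s; rewrite -eq_s ltnNge ltnW.
have ne_rs : (r == s) = false.
  by apply: contraTF lt_rs => /eqP ->; rewrite ltnn.
have /submK eE : (U_(s) <= b + U_(r))%MM.
  by rewrite lep1mP mnmDE addn_eq0 negb_and -lt0n (leq_ltn_trans _ lt_s).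
(* Here [e] is b x_r / x_s. Exchanging variables of one block keeps the image, and since r < s the
   first change is an increase at [r], so [e] comes before [b]. *)
set e := (_ - _)%MM in eE; exists r, e; split; rewrite ?lem_subr //.
have deg_e : block_degree e = block_degree b.
  apply: (@addIm _ (block_degree U_(s)%MM)).
  by rewrite -block_degreeD eE block_degreeD !block_degree1 sr.
rewrite (mem_take_sorted 0%MM _ w_sorted) // wE deg_e ub lt_lift_key deg_e.
rewrite ltnn eqxx /=; apply/ltmcP.
  by rewrite -mdeg_block_degree -deg_e mdeg_block_degree.
exists r => [i lt_i|]; rewrite mnmBE mnmDE !mnm1E.
  have /negPf-> : r != i by apply: contraTneq lt_i => ->; rewrite ltnn.
  have /negPf-> : s != i.
    by apply: contraTneq lt_i => <-; rewrite -leqNgt ltnW.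
  by rewrite addn0 subn0.
by rewrite eqxx eq_sym ne_rs subn0 addn1.
Qed.

End Lift.

Theorem proposition1p6 (K : fieldType) (n : nat)
  (d : 'I_n -> nat) (d_gt0 : forall j, (0 < d j)%N)
  (I : {mpoly K[n]} -> Prop) (I_monomial : monomial_ideal I) :
  linear_quotients I -> linear_quotients (expansion d I).
Proof.
case/linear_quotientsE => u [u_uniq Iu u_anti u_lin].
have [w [w_sorted wE]] := lift_exists d u.
apply/linear_quotientsE; exists w; split.
- apply: (sorted_uniq _ _ w_sorted) => [b b' b''|b]; last exact: ltxx.
  exact: lt_trans.
(* Independence of the chosen generators allows the expansion to be computed from [u]. *)
- move=> f; rewrite (expansionE Iu f); exact: expansion_generators_lift.
- exact: lift_antichain wE u_anti.
- exact: lift_linear_steps w_sorted wE u_uniq u_lin.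
Qed.
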